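(* Let $n\ge 1$ and $k\ge 1$ be integers. The number $\mathrm{sn}_{n,k}$ of smooth necklaces of length $n$ over an alphabet of $k$ letters is given by $$\mathrm{sn}_{n,k}=\frac{1}{n}\sum_{i=1}^k\sum_{j\mid n}\phi(j)\left[1+2\cos\Bigl(\frac{i\pi}{k+1}\Bigr)\right]^{n/j},$$ where $\phi$ is Euler's totient function and the inner sum is over the positive divisors $j$ of $n$.
   Context: $[k]=\{1,2,\ldots,k\}$, and $[k]^n$ is the set of words $\sigma=\sigma_1\cdots\sigma_n$ of length $n$ over $[k]$. A word $\sigma\in[k]^n$ is smooth if $|\sigma_{i+1}-\sigma_i|\le 1$ for all $1\le i\le n-1$, and smooth cyclic if it is smooth and in addition $|\sigma_n-\sigma_1|\le 1$ (so every word of length $1$ is smooth cyclic). Two words $\sigma,\pi\in[k]^n$ are rotation equivalent if there is an index $i$, $1\le i\le n$, with $\pi_i\pi_{i+1}\cdots\pi_n\pi_1\pi_2\cdots\pi_{i-1}=\sigma$. A smooth necklace of length $n$ over $[k]$ is a rotation-equivalence class of smooth cyclic words in $[k]^n$. *)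

(* Defs.v *)
From HB Require Import structures.
From mathcomp Require Import all_boot all_order all_algebra.
From mathcomp Require Import reals trigo.

Set Implicit Arguments.
Unset Strict Implicit.
Unset Printing Implicit Defensive.

(* A word of length n over [k] = {1, ..., k} is an n.-tuple 'I_k; the element
   a : 'I_k, with 0 <= a < k, stands for the letter a + 1. *)

(* The difference is taken in int: subtraction on nat is truncated. *)
Definition close (k : nat) (a b : 'I_k) : bool := (`|a%:Z - b%:Z| <= 1)%R.

Definition smooth (n k : nat) (w : n.-tuple 'I_k) : bool := sorted (@close k) w.

Definition smooth_cyclic (n k : nat) (w : n.-tuple 'I_k) : bool :=
  smooth w && (if tval w is x :: s then close (last x s) x else true).

(* i : 'I_n is the 0-based starting position of the rotation:
   rot i p = p_(i+1) ... p_n p_1 ... p_i. *)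
Definition rotation_equivalent (n k : nat) (s p : n.-tuple 'I_k) : bool :=
  [exists i : 'I_n, rot i p == s :> seq 'I_k].

Definition smooth_necklaces (n k : nat) : {set {set n.-tuple 'I_k}} :=
  equivalence_partition (@rotation_equivalent n k)
    [set w : n.-tuple 'I_k | smooth_cyclic w].

Definition sn (n k : nat) : nat := #|smooth_necklaces n k|.

(* Main.v *)
Require Import Defs.
From HB Require Import structures.
From mathcomp Require Import fingroup action.
From mathcomp Require Import all_boot all_order all_algebra.
From mathcomp Require Import reals trigo.
From mathcomp Require Import ring zify.

(** The rotations of words of length n are an action of the cyclic group Z/n,
    and the smooth necklaces are its orbits on the smooth cyclic words.  By
    the Cauchy-Frobenius (Burnside) orbit count, [n * sn n k] is therefore the
    sum, over the n rotations, of the number of smooth cyclic words that the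
    rotation fixes ([sn_burnside]).

    A word is fixed by rotation by i iff it is fixed by rotation by
    [d = gcdn i n], that is, iff it is an (n/d)-fold repetition of a word of
    length d; and the repetition is smooth cyclic iff the short word is
    ([card_cycle_rot_fix]).  Since [totient j] of the indices i have
    [gcdn i n = n %/ j], it remains to count the smooth cyclic words of each
    length ([sum_gcdn]).

    These words are the closed walks in the graph on [k] that joins letters
    differing by at most 1, so their number is the trace of a power of its
    adjacency matrix A ([card_closed_walks_trace]).  This matrix is the
    identity plus the adjacency matrix of a path, and it is diagonalised by
    the vectors [sin (j * theta_i)] with [theta_i = i * pi / (k + 1)], for the
    eigenvalues [1 + 2 * cos theta_i]: the addition formula gives the
    eigenvector equation, and the sines vanish at the two missing neighbours
    0 and k + 1 of the path ([sine_mx_adj]).  The power sums of these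
    eigenvalues are the traces ([trace_adj_exp]). *)

Set Implicit Arguments.
Unset Strict Implicit.
Unset Printing Implicit Defensive.

Import Order.TTheory GRing.Theory Num.Theory.
Local Open Scope ring_scope.

(** * Words fixed by a rotation *)

(** Iterating the one-step rotation turns statements about rotation amounts
    modulo the length into statements about sums and multiples. *)
Lemma rot_iter T (w : seq T) i : (i <= size w)%N -> rot i w = iter i (rot 1) w.
Proof.
elim: i => [|i IHi] lt_iw; first by rewrite rot0.
by rewrite rotS // IHi // ltnW.
Qed.

Lemma iter_rot_modn T (w : seq T) i : iter i (rot 1) w = rot (i %% size w) w.
Proof.
case: (posnP (size w)) => [/size0nil->|w_gt0].
  by elim: i => [|i /= ->].
rewrite rot_iter ?(ltnW (ltn_pmod _ _)) // {1}(divn_eq i (size w)) addnC iterD.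
congr iter; rewrite iterM; apply: iter_fix.
by rewrite -rot_iter // rot_size.
Qed.

(** By Bezout, [gcdn m n + a * n] is a multiple of m for some a, and
    [a * n] of these steps fix x. *)
Lemma iter_fix_gcdn T (f : T -> T) x m n : (0 < m)%N ->
  iter m f x = x -> iter n f x = x -> iter (gcdn m n) f x = x.
Proof.
move=> m_gt0 fm fn; have [a _ /dvdnP[b eq_b]] := Bezoutl n m_gt0.
have fan : iter (a * n) f x = x by rewrite iterM iter_fix.
by rewrite -{1}fan -iterD eq_b iterM iter_fix.
Qed.

Lemma rot_fix_gcdn (T : eqType) (w : seq T) i : (i <= size w)%N ->
  (rot i w == w) = (rot (gcdn i (size w)) w == w).
Proof.
case: (posnP (size w)) => [/size0nil-> // | w_gt0] le_iw.
have le_gw : (gcdn i (size w) <= size w)%N by rewrite dvdn_leq ?dvdn_gcdr.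
rewrite !rot_iter //; apply/eqP/eqP => fix_w.
  rewrite gcdnC; apply: iter_fix_gcdn => //.
  by rewrite -rot_iter // rot_size.
by case/dvdnP: (dvdn_gcdl i (size w)) => q {1}->; rewrite iterM iter_fix.
Qed.

(** A word commuting with u begins with u; what is left still commutes. *)
Lemma catC_flatten_nseq T (u v : seq T) m :
  size v = (m * size u)%N -> v ++ u = u ++ v -> v = flatten (nseq m u).
Proof.
elim: m v => [|m IHm] v /= sz_v eq_vu; first by apply: size0nil.
have le_uv : (size u <= size v)%N by rewrite sz_v mulSn leq_addr.
have [v' def_v] : exists v', v = u ++ v'.
  exists (drop (size u) v).
  have {1}<- : take (size u) v = u.
    have /(congr1 (take (size u))) := eq_vu.
    by rewrite takel_cat // take_size_cat.
  by rewrite cat_take_drop.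
subst v; congr (u ++ _); apply: IHm.
  by move: sz_v; rewrite size_cat mulSn => /addnI.
have /(congr1 (drop (size u))) := eq_vu.
by rewrite -catA !drop_size_cat.
Qed.

Lemma rot_fix_flatten (T : eqType) (w : seq T) d m :
  size w = (m * d)%N -> (0 < m)%N -> rot d w = w -> w = flatten (nseq m (take d w)).
Proof.
case: m => // m sz_w _ fix_w.
have sz_t : size (take d w) = d by rewrite size_takel // sz_w leq_pmull.
rewrite /= -{1}(cat_take_drop d w); congr (_ ++ _).
apply: catC_flatten_nseq; first by rewrite size_drop sz_w sz_t mulSn addKn.
by rewrite cat_take_drop -[RHS]fix_w.
Qed.

Lemma rot_flatten_nseq T (u : seq T) m :
  rot (size u) (flatten (nseq m u)) = flatten (nseq m u).
Proof.
case: m => [|m] //=; rewrite rot_size_cat.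
by elim: m => [|m IHm] /=; rewrite ?cats0 // -catA IHm.
Qed.

(** The junction between two copies of u is the junction that closes u into a
    cycle. *)
Lemma cycle_flatten_nseq T (e : rel T) (u : seq T) m : (0 < m)%N ->
  cycle e (flatten (nseq m u)) = cycle e u.
Proof.
case: u => [|x s]; first by elim: m => // -[].
case: m => // m _; set u := x :: s.
have last_rep k : last (last x s) (flatten (nseq k u)) = last x s.
  by elim: k => //= k; rewrite last_cat.
have def_rep k : flatten (nseq k.+1 u) = u ++ flatten (nseq k u) by [].
rewrite !(cycle_path x) def_rep last_cat last_rep -def_rep.
elim: m => [|m IHm]; first by rewrite def_rep cats0.
by rewrite def_rep cat_path IHm andbb.
Qed.

Lemma smooth_cyclicE n k (w : n.-tuple 'I_k) :
  smooth_cyclic w = cycle (@close k) w.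
Proof.
rewrite /smooth_cyclic /smooth.
by case: (tval w) => [|x s] //=; rewrite rcons_path.
Qed.

(** A closed walk is recorded by its n successive vertices, so for [close] these
    are the smooth cyclic words. *)
Definition card_closed_walks (T : finType) (e : rel T) n := #|[set w : n.-tuple T | cycle e w]|.

Lemma rep_subproof T m d (u : d.-tuple T) : size (flatten (nseq m (tval u))) == (m * d)%N.
Proof. by rewrite size_flatten /shape map_nseq sumn_nseq size_tuple mulnC. Qed.

Definition rep T m d (u : d.-tuple T) : (m * d).-tuple T := Tuple (rep_subproof m u).

(** The words fixed by rotation by i are the repetitions of words of length
    [gcdn i n], and repetition is injective. *)
Lemma card_cycle_rot_fix (T : finType) (e : rel T) n i :
  (0 < n)%N -> (i <= n)%N ->
  #|[set w : n.-tuple T | cycle e w && (rot i w == w)]| = card_closed_walks e (gcdn i n).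
Proof.
move=> n_gt0 le_in; set d := gcdn i n.
have d_gt0 : (0 < d)%N by rewrite gcdn_gt0 n_gt0 orbT.
have [m def_n] : {m | n = (m * d)%N} by exists (n %/ d)%N; rewrite divnK ?dvdn_gcdr.
have m_gt0 : (0 < m)%N by move: n_gt0; rewrite def_n muln_gt0 => /andP[].
have fixE (w : n.-tuple T) : (rot i w == w) = (rot d w == w :> seq T).
  by rewrite rot_fix_gcdn size_tuple.
under eq_finset => w do rewrite fixE.
clearbody d; clear le_in fixE; subst n.
rewrite /card_closed_walks -(card_in_imset (f := @rep T m d)); last first.
  move=> u v _ _ /(congr1 (fun w => take d (tval w))) /=.
  case: (m) m_gt0 => //= m' _.
  by rewrite !take_size_cat ?size_tuple // => /val_inj.
apply: eq_card => w; apply/idP/imsetP; rewrite inE.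
  case/andP=> cyc_w /eqP fix_w.
  have sz_t : size (take d w) == d.
    by rewrite size_takel // size_tuple leq_pmull.
  have def_w := rot_fix_flatten (size_tuple w) m_gt0 fix_w.
  exists (Tuple sz_t); last exact/val_inj.
  by rewrite inE /= -(cycle_flatten_nseq _ _ m_gt0) -def_w.
case=> u; rewrite inE => cyc_u -> /=.
by rewrite cycle_flatten_nseq // cyc_u -{1}(size_tuple u) rot_flatten_nseq eqxx.
Qed.

(** * Orbits of rotations *)

Section RotationAction.
Variables (T : finType) (n : nat).
Implicit Types (w : n.+1.-tuple T) (a : 'I_n.+1).

Definition rot_act w a : n.+1.-tuple T := [tuple of rot a w].

Lemma rot_act1 : rot_act^~ 1%g =1 id.
Proof. by move=> w; apply: val_inj; rewrite /= rot0. Qed.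

Lemma rot_actM w : act_morph rot_act w.
Proof.
move=> a b; apply: val_inj => /=.
have := iter_rot_modn w (b + a); rewrite size_tuple addnC => <-.
rewrite addnC iterD.
by rewrite -!rot_iter ?size_rot ?size_tuple // ltnW.
Qed.

Canonical rot_action := TotalAction rot_act1 rot_actM.
End RotationAction.

(** The orbit count needs a group with exactly n elements, while the
    rotations may be fewer (for k = 1 all are trivial): hence the action of the
    additive group ['I_n] instead of the group that the rotations form. *)
Lemma sn_burnside n k :
  (sn n.+1 k * n.+1)%N = (\sum_(i < n.+1) card_closed_walks (@close k) (gcdn i n.+1))%N.
Proof.
pose S := [set w : n.+1.-tuple 'I_k | smooth_cyclic w].
pose to := rot_action 'I_k n.
have actsS : [acts [set: 'I_n.+1], on S | to].
  apply/actsP => a _ w.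
  by rewrite !inE !smooth_cyclicE rot_cycle.
have := Frobenius_Cauchy actsS.
rewrite cardsT card_ord.
have -> : #|[set action.orbit to [set: 'I_n.+1]%G w | w in S]| = sn n.+1 k.
  rewrite /sn /smooth_necklaces /equivalence_partition -/S.
  congr #|pred_of_set _|; apply: eq_in_imset => w Sw.
  apply/setP=> v; rewrite [RHS]inE.
  rewrite -(@orbit_sym _ _ to setT%G).
  apply/idP/andP => [/orbitP[a _ def_w]|[Sv /existsP[a /eqP def_w]]].
    split; first by rewrite -(actsP actsS a (in_setT a)) [to _ _]def_w.
    by apply/existsP; exists a; rewrite -def_w.
  by apply/orbitP; exists a; rewrite ?in_setT //; apply: val_inj.
move=> <-; apply: eq_big => [a|a _]; first by rewrite in_setT.
rewrite -card_cycle_rot_fix ?(ltnW (ltn_ord a)) //; apply: eq_card => w.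
by rewrite in_setI !inE sub1set inE smooth_cyclicE -val_eqE.
Qed.

(** * Summing over greatest common divisors *)

Lemma divnn_divK d n : (0 < n)%N -> (d %| n)%N -> (n %/ (n %/ d))%N = d.
Proof. by move=> n_gt0 dv_dn; rewrite divnA // mulKn. Qed.

(** The i < n with [gcdn i n = d], where [n = d * j], are the [d * c] with
    [c < j] coprime to j. *)
Lemma sum_gcdn (V : nmodType) (F : nat -> V) n : (0 < n)%N ->
  \sum_(i < n) F (gcdn i n) = \sum_(j <- divisors n) F (n %/ j)%N *+ totient j.
Proof.
move=> n_gt0.
have cnt j : (j %| n)%N -> #|[set i : 'I_n | gcdn i n == (n %/ j)%N]| = totient j.
  case/dvdnP=> d def_n; subst n.
  move: (n_gt0); rewrite muln_gt0 => /andP[d_gt0 j_gt0].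
  have lt_in (c : 'I_j) : (d * c < d * j)%N by rewrite ltn_pmul2l.
  have -> : totient j = #|[set c : 'I_j | coprime j c]|.
    rewrite totient_count_coprime big_mkord -sum1_card [RHS]big_mkcond /=.
    by apply: eq_bigr => c _; rewrite inE; case: coprime.
  rewrite -(card_imset _ (f := fun c => Ordinal (lt_in c))); last first.
    by move=> c c' /(congr1 val)/eqP /=; rewrite eqn_pmul2l // => /eqP/val_inj.
  apply: eq_card => i; rewrite mulnK // inE; apply/eqP/imsetP => [gcd_i|[c]].
    have /dvdnP[c def_i] : (d %| i)%N by have := dvdn_gcdl i (d * j); rewrite gcd_i.
    have lt_cj : (c < j)%N by move: (ltn_ord i); rewrite def_i mulnC ltn_pmul2l.
    exists (Ordinal lt_cj); last by apply: val_inj; rewrite /= def_i mulnC.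
    move: gcd_i; rewrite inE /= def_i mulnC -muln_gcdr -{2}(muln1 d) => /eqP.
    by rewrite eqn_pmul2l // gcdnC.
  by rewrite inE => /eqP cop ->; rewrite /= -muln_gcdr gcdnC cop muln1.
have gcd_div (i : 'I_n) : (n %/ gcdn i n \in divisors n)%N.
  rewrite -dvdn_divisors //; apply/dvdnP; exists (gcdn i n).
  by rewrite mulnC divnK ?dvdn_gcdr.
have -> : \sum_(i < n) F (gcdn i n) =
    \sum_(i < n) \sum_(j <- divisors n | j == (n %/ gcdn i n)%N) F (n %/ j)%N.
  apply: eq_bigr => i _.
  rewrite -big_filter filter_pred1_uniq ?divisors_uniq // big_seq1.
  by rewrite divnn_divK ?dvdn_gcdr.
rewrite (exchange_big_dep xpredT) //= big_seq [RHS]big_seq.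
apply: eq_bigr => j; rewrite -dvdn_divisors // => dv_j.
rewrite sumr_const -(cnt j dv_j); congr (_ *+ _); apply: eq_card => i.
rewrite !inE unfold_in /=.
by apply/eqP/eqP => [-> | ->]; rewrite divnn_divK ?dvdn_gcdr.
Qed.

(** * Closed walks and the transfer matrix *)

Lemma big_tuple_cons (R : nmodType) (T : finType) n (F : seq T -> R) :
  \sum_(w : n.+1.-tuple T) F w = \sum_x \sum_(s : n.-tuple T) F (x :: s).
Proof.
rewrite pair_bigA /=.
rewrite (reindex (fun p : T * n.-tuple T => cons_tuple p.1 p.2)) //=.
exists (fun w : n.+1.-tuple T => (thead w, behead_tuple w)) => [[x s] _|w _] /=.
  by congr (_, _); apply: val_inj.
by rewrite [RHS](tuple_eta w); apply: val_inj.
Qed.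

Definition adj_mx (R : nzSemiRingType) k (e : rel 'I_k.+1) : 'M[R]_k.+1 :=
  \matrix_(a, b) (e a b)%:R.

(** The tuple lists the intermediate vertices of the walk, which therefore has
    one more step than the tuple has entries. *)
Lemma sum_path_mxE (R : nzSemiRingType) k (e : rel 'I_k.+1) n x y :
  \sum_(s : n.-tuple 'I_k.+1) (path e x (rcons s y))%:R = (adj_mx R e ^+ n.+1) x y.
Proof.
elim: n x => [|n IHn] x.
  rewrite (big_pred1 [tuple]); last by move=> s; rewrite [s]tuple0 [RHS]eqxx.
  by rewrite /= andbT expr1 mxE.
rewrite (big_tuple_cons _ (fun s : seq _ => (path e x (rcons s y))%:R)) exprS mxE.
apply: eq_bigr => a _; rewrite -IHn mxE mulr_sumr.
by apply: eq_bigr => s _; rewrite /= -mulnb natrM.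
Qed.

Lemma card_closed_walks_trace (R : nzSemiRingType) k (e : rel 'I_k.+1) n : (0 < n)%N ->
  (card_closed_walks e n)%:R = \tr (adj_mx R e ^+ n).
Proof.
case: n => // n _; rewrite /card_closed_walks -sum1_card natr_sum big_mkcond /=.
under eq_bigr => w _ do rewrite inE -mulrb.
rewrite (big_tuple_cons _ (fun w : seq _ => (cycle e w)%:R)).
by apply: eq_bigr => x _; rewrite -sum_path_mxE.
Qed.

(** * Diagonalisation of the adjacency matrix *)

Definition angle (R : realType) k (i : 'I_k.+1) : R := i.+1%:R * pi / k.+2%:R.

(** Row i is the eigenvector for [angle R i]; indices are shifted by one
    because ['I_k.+1] starts at 0 and the letters at 1. *)
Definition sine_mx (R : realType) k : 'M[R]_k.+1 :=
  \matrix_(i, j) sin (j.+1%:R * angle R i).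

Definition eig_row (R : realType) k : 'rV[R]_k.+1 :=
  \row_i (1 + 2 * cos (angle R i)).

Lemma angle_itv (R : realType) k (i : 'I_k.+1) : 0 < angle R i < pi.
Proof.
have pi0 := pi_gt0 R.
rewrite /angle divr_gt0 ?mulr_gt0 ?ltr0n //= ltr_pdivrMr ?ltr0n // mulrC.
by rewrite ltr_pM2l // ltr_nat ltnS.
Qed.

Lemma eig_row_inj (R : realType) k : injective ((eig_row R k) 0).
Proof.
move=> i j; rewrite !mxE => /addrI eq_ij.
have {}eq_ij : cos (angle R i) = cos (angle R j) by apply: mulfI eq_ij; rewrite pnatr_eq0.
have in_0pi (l : 'I_k.+1) : angle R l \in `[0, pi] by rewrite in_itv /= !ltW //; case/andP: (angle_itv R l).
have := cos_inj (in_0pi i) (in_0pi j) eq_ij.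
rewrite /angle => eq_a; apply: val_inj; apply/eqP; rewrite -eqSS -(eqr_nat R).
have nz : pi / k.+2%:R != 0 :> R by rewrite mulf_neq0 ?invr_eq0 ?pnatr_eq0 // gt_eqF // pi_gt0.
by rewrite -(inj_eq (mulIf nz)) !mulrA; apply/eqP.
Qed.

Lemma sine_mx_sym (R : realType) k : (sine_mx R k)^T = sine_mx R k.
Proof.
by apply/matrixP=> i j; rewrite !mxE /angle; congr sin; ring.
Qed.

Lemma sum_mulrb_eq (V : nmodType) n (g : nat -> V) m :
  \sum_(i < n) g i *+ (i == m :> nat) = g m *+ (m < n)%N.
Proof.
case: ltnP => [lt_mn | le_nm]; last first.
  by rewrite big1 // => i _; rewrite ltn_eqF // (leq_trans (ltn_ord i)).
rewrite (bigD1 (Ordinal lt_mn)) //= eqxx big1 ?addr0 // => i ne_i.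
by rewrite -val_eqE in ne_i; rewrite (negbTE ne_i).
Qed.

(** Letters are numbered from 1, so the letter j.+1 has neighbours j and j.+2;
    the vanishing of f at 0 and [k.+1] accounts for the neighbours that the two
    extreme letters lack. *)
Lemma sum_close (V : nmodType) k (j : 'I_k) (f : nat -> V) :
  f 0%N = 0 -> f k.+1 = 0 ->
  \sum_(i < k) f i.+1 *+ close i j = f j + f j.+1 + f j.+2.
Proof.
move=> f0 fk.
transitivity (\sum_(i < k) (f i.+1 *+ (i.+1 == j) + f i.+1 *+ (i == j :> nat)
                            + f i.+1 *+ (i == j.+1 :> nat))).
  (* i.+1 = j, i = j and i = j.+1 exclude one another, so their indicators add
     up to that of closeness *)
  apply: eq_bigr => i _; rewrite -!mulrnDr /close; congr (_ *+ _). lia.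
rewrite !big_split /=; congr (_ + _ + _); last first.
- rewrite (sum_mulrb_eq _ (fun i => f i.+1)); case: ltnP => // le_kj.
  by rewrite (_ : j.+1 = k) // ; apply/eqP; rewrite eqn_leq le_kj ltn_ord.
- by rewrite (sum_mulrb_eq _ (fun i => f i.+1)) ltn_ord.
case: j => -[|j] /= lt_jk; first by rewrite f0 big1.
by rewrite (sum_mulrb_eq _ (fun i => f i.+1)) ltnW.
Qed.

(** This is [sin (x - t) + sin x + sin (x + t) = (1 + 2 * cos t) * sin x]. *)
Lemma sine_mx_adj (R : realType) k :
  sine_mx R k *m adj_mx R (@close k.+1) = diag_mx (eig_row R k) *m sine_mx R k.
Proof.
apply/matrixP=> i j; rewrite mul_diag_mx !mxE; set t := angle R i.
under eq_bigr => l _ do rewrite !mxE mulr_natr.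
rewrite (sum_close j (f := fun l => sin (l%:R * t))) ?mul0r ?sin0 //; last first.
  have -> : k.+2%:R * t = i.+1%:R * pi by rewrite mulrC divfK ?pnatr_eq0.
  elim: {t} i.+1 => [|m IHm]; first by rewrite mul0r sin0.
  by rewrite mulrSr mulrDl mul1r sinDpi IHm oppr0.
have -> : j%:R * t = j.+1%:R * t - t by rewrite mulrSr; ring.
have -> : j.+2%:R * t = j.+1%:R * t + t by rewrite mulrSr; ring.
rewrite sinB sinD; ring.
Qed.

(** Entry (i, j) of the commutation says that [A i j] is killed by
    [d 0 i - d 0 j]. *)
Lemma comm_diag_mx_diag (F : idomainType) n (d : 'rV[F]_n) (A : 'M[F]_n) :
  injective (d 0) -> A *m diag_mx d = diag_mx d *m A -> is_diag_mx A.
Proof.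
move=> d_inj /matrixP comm_Ad; apply/is_diag_mxP => i j ne_ij.
have := comm_Ad i j; rewrite mul_mx_diag mul_diag_mx !mxE mulrC => /eqP.
rewrite -subr_eq0 -mulrBl mulf_eq0 subr_eq0 => /orP[/eqP/d_inj eq_ij | /eqP //].
by rewrite eq_ij eqxx in ne_ij.
Qed.

(** The sine matrix S is symmetric, like the adjacency matrix, so transposing
    [S *m A = D *m S] shows that [S *m S] commutes with D.  The eigenvalues are
    distinct, so [S *m S] is diagonal, and its diagonal entries are sums of
    squares whose first term is positive. *)
Lemma sine_mx_unit (R : realType) k : sine_mx R k \in unitmx.
Proof.
set S := sine_mx R k; set D := diag_mx (eig_row R k).
set A := adj_mx R (@close k.+1).
have SA : S *m A = D *m S := sine_mx_adj R k.
have A_sym : A^T = A.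
  by apply/matrixP=> i j; rewrite !mxE /close distrC.
have AS : A *m S = S *m D.
  have := congr1 trmx SA.
  by rewrite !trmx_mul sine_mx_sym A_sym tr_diag_mx.
have SSD : (S *m S) *m D = D *m (S *m S).
  by rewrite -[LHS]mulmxA -AS [LHS]mulmxA SA -[LHS]mulmxA.
have /diag_mxP[d SS_d] := comm_diag_mx_diag (@eig_row_inj R k) SSD.
have SS_gt0 i : 0 < (S *m S) i i.
  rewrite mxE (bigD1 ord0) //=.
  rewrite ltr_wpDr ?sumr_ge0 // => [l _|].
    by rewrite -{2}[S]sine_mx_sym [_^T _ _]mxE -expr2 sqr_ge0.
  rewrite -{2}[S]sine_mx_sym [_^T _ _]mxE -expr2 exprn_gt0 //.
  by rewrite mxE mul1r; apply: sin_gt0_pi; apply: angle_itv.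
have : S *m S \in unitmx.
  rewrite SS_d unitmxE det_diag unitfE; apply/prodf_neq0 => i _.
  by have := SS_gt0 i; rewrite SS_d mxE eqxx => /gt_eqF->.
by rewrite unitmx_mul => /andP[].
Qed.

Lemma trace_adj_exp (R : realType) k n :
  \tr (adj_mx R (@close k.+1) ^+ n) = \sum_i (eig_row R k) 0 i ^+ n.
Proof.
set A := adj_mx R _; set S := sine_mx R k; set D := diag_mx (eig_row R k).
have uS : S \in unitmx := sine_mx_unit R k.
have SAn : S *m A ^+ n = D ^+ n *m S.
  elim: n => [|n IHn]; first by rewrite !expr0 mul1mx mulmx1.
  by rewrite !exprS -!mulmxE mulmxA sine_mx_adj -mulmxA IHn mulmxA.
have -> : A ^+ n = invmx S *m (D ^+ n *m S) by rewrite -SAn mulKmx.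
rewrite mxtrace_mulC mulmxK // /D.
have -> : diag_mx (eig_row R k) ^+ n = diag_mx (map_mx (fun x => x ^+ n) (eig_row R k)).
  elim: (n) => [|m IHm].
    by apply/matrixP=> i j; rewrite !mxE expr0.
  rewrite exprS IHm; apply/matrixP=> i j.
  by rewrite -mulmxE mul_diag_mx !mxE exprS mulrnAr.
by rewrite mxtrace_diag; apply: eq_bigr => i _; rewrite mxE.
Qed.

(** * The count of smooth necklaces *)

Theorem theorem4p1 (R : realType) (n k : nat) (hn : (1 <= n)%N) (hk : (1 <= k)%N) :
  (sn n k)%:R =
  n%:R^-1 * \sum_(1 <= i < k.+1) \sum_(j <- divisors n)
    (totient j)%:R * (1 + 2 * cos (i%:R * pi / (k + 1)%:R)) ^+ (n %/ j)%N :> R.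
Proof.
case: n hn => // n _; case: k hk => // k _.
apply: (mulfI (x := n.+1%:R)); first by rewrite pnatr_eq0.
rewrite mulVKf ?pnatr_eq0 // mulrC -natrM sn_burnside natr_sum.
pose tr_pow m := \tr (adj_mx R (@close k.+1) ^+ m).
transitivity (\sum_(i < n.+1) tr_pow (gcdn i n.+1)).
  by apply: eq_bigr => i _; rewrite card_closed_walks_trace // gcdn_gt0 orbT.
rewrite sum_gcdn // exchange_big; apply: eq_bigr => j _.
rewrite /tr_pow trace_adj_exp -[LHS]mulr_natl mulr_sumr big_add1 big_mkord.
by apply: eq_bigr => i _; rewrite !mxE /angle addn1.
Qed.
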